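(* Let $k\geqslant1$ and let $$\varrho(z)=\sum_{\gamma=\begin{pmatrix}a&b\\c&d\end{pmatrix}\in G}\frac{\det(\gamma)^k}{(az+b)^k(cz+d)^k},$$ so that $\varrho(z)\,(\mathrm{d}z)^k=\sum_{\gamma\in G}\gamma^*s(z;\infty,0)^k$. Then $\varrho=-P_{2k,k}$, where $P_{2k,k}$ is the Drinfeld–Poincaré series.
   Context: $q$ is an odd prime power, $A=\mathbb{F}_q[T]$, $G=\mathrm{GL}_2(A)$, $F_\infty=\mathbb{F}_q((1/T))$, $\mathbb{C}_\infty$ is the completion of an algebraic closure of $F_\infty$, $z\in\Omega=\mathbb{C}_\infty\setminus F_\infty$; $j_\gamma(z)=cz+d$ for $\gamma=\begin{pmatrix}a&b\\c&d\end{pmatrix}$. $s(z;\infty,0)=\mathrm{d}z/z$, and $\gamma^*$ denotes pullback under $z\mapsto\gamma z$. The series $\varrho$ converges locally uniformly on $\Omega$. $e_A(z)=z\prod_{b\in A\setminus\{0\}}(1-z/b)$ and $t_A=1/e_A$. For $n\geqslant1$, the $n$-th Goss polynomial $G_{n,A}(X)\in\mathbb{C}_\infty[X]$ is the unique polynomial with $\sum_{b\in A}(z-b)^{-n}=G_{n,A}(t_A(z))$ for all $z\notin A$. For $w,n\geqslant1$, with $m$ the class of $n$ modulo $q-1$ and $K=\begin{pmatrix}\mathbb{F}_q^\times&A\\0&1\end{pmatrix}$, the Drinfeld–Poincaré series is $$P_{w,n}(z)=\sum_{[\gamma]\in K\backslash G}\frac{\det(\gamma)^m}{j_\gamma(z)^w}\,G_{n,A}(t_A(\gamma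 z)).$$ *)

(* Defs.v *)
From HB Require Import structures.
From mathcomp Require Import all_boot all_order all_algebra finmap.
From mathcomp Require Import boolp classical_sets functions reals topology.
From mathcomp Require Import metric_structure sequences.
From mathcomp Require summability.

Set Implicit Arguments.
Unset Strict Implicit.
Unset Printing Implicit Defensive.

Import Order.TTheory GRing.Theory Num.Theory.

Local Open Scope classical_set_scope.
Local Open Scope ring_scope.

(* Complete fields for a non-archimedean absolute value [vabs]. The norms of
   the library cannot be used in positive characteristic: their axiom [normrMn]
   forces `|x *+ n| = `|x| *+ n. *)
HB.mixin Record isUltrametricField (R : realType) C
    of GRing.Field C & Metric R C := {
  mdistDr : forall x y z : C, mdist (x + z) (y + z) = mdist x y;
  mdistM0 : forall x y : C, mdist (x * y) 0 = mdist x 0 * mdist y 0;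
  mdist_ultra : forall x y z : C,
    mdist x z <= Num.max (mdist x y) (mdist y z)
}.

#[short(type="completeUltrametricFieldType")]
HB.structure Definition CompleteUltrametricField (R : realType) :=
  { C of isUltrametricField R C & GRing.Field C & Metric R C
       & CompletePseudoMetric R C }.

Definition vabs (R : realType) (C : completeUltrametricFieldType R) (x : C) : R :=
  mdist x 0.

Section InfiniteSums.
Context {R : realType} {C : completeUltrametricFieldType R} {I : choiceType}.
Implicit Types (D : set I) (f : I -> C).

(* Limits along the directed set of finite subsets of the index set, that is,
   unordered sums and products. *)
Definition usums D f : set_system C :=
  (fun S : {fset I} => \sum_(i <- S | i \in D) f i) @ summability.totally.

Definition usum D f : C := lim (usums D f).

Definition usummable D f : Prop := cvg (usums D f).

Definition uprod D f : C :=
  lim ((fun S : {fset I} => \prod_(i <- S | i \in D) f i)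
         @ summability.totally).

End InfiniteSums.

Section Drinfeld.
Context {R : realType} {F : finFieldType} {C : completeUltrametricFieldType R}.
Variable iota : {rmorphism {poly F} -> C}.

(* F((1/T)) inside C: the sums of the series sum_i (a_i * T^(N - i)). *)
Definition Finfty : set C :=
  [set x | exists (N : nat) (a : nat -> F),
    series (fun i => iota (a i)%:P * (iota 'X ^+ N / iota 'X ^+ i)) @ \oo --> x].

Definition Finfty_bar : set C :=
  [set x | exists p : {poly C},
    [/\ p != 0, forall i, Finfty p`_i & root p x]].

(* C is the completion of an algebraic closure of F((1/T)) : it is complete,
   and [Finfty_bar] is an algebraic closure of F((1/T)) and is dense in C. *)
Record is_Cinfty : Prop := IsCinfty {
  vabs_iota : forall a : {poly F},
    a != 0 -> vabs (iota a) = #|F|%:R ^+ (size a).-1;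
  Finfty_bar_closed : forall p : {poly C},
    (1 < size p)%N -> (forall i, Finfty p`_i) -> exists x, root p x;
  Finfty_bar_dense : dense Finfty_bar
}.

Definition Omega : set C := ~` Finfty.

Definition e_A (z : C) : C :=
  z * uprod [set b : {poly F} | b != 0] (fun b => 1 - z / iota b).

Definition t_A (z : C) : C := (e_A z)^-1.

(* Definite description: the Goss polynomial is the unique element of the set. *)
Definition goss (n : nat) : {poly C} :=
  xget 0 [set p : {poly C} | forall z : C, ~ range iota z ->
            usum setT (fun b : {poly F} => (z - iota b) ^- n) = p.[t_A z]].

Implicit Types g : 'M[{poly F}]_2.

Definition GL2A : set 'M[{poly F}]_2 := [set g | g \in unitmx].

Definition numer g (z : C) : C := iota (g 0 0) * z + iota (g 0 1).
Definition autom g (z : C) : C := iota (g 1 0) * z + iota (g 1 1).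
Definition moebius g (z : C) : C := numer g z / autom g z.

Definition Ksub : set 'M[{poly F}]_2 :=
  [set g | [/\ exists2 u : F, u != 0 & g 0 0 = u%:P, g 1 0 = 0 & g 1 1 = 1]].

Definition K_coset g : set 'M[{poly F}]_2 := [set h *m g | h in Ksub].

(* The quotient K\G, a set of right cosets Kg. *)
Definition KG : set (set 'M[{poly F}]_2) := [set K_coset g | g in GL2A].

Definition K_repr (X : set 'M[{poly F}]_2) : 'M[{poly F}]_2 := xget 1%:M X.

(* The class m of n modulo q - 1 is given by its residue; det(g) lies in
   F_q^*. The summand does not depend on the representative of the coset. *)
Definition poincare_term (w n : nat) (z : C) (X : set 'M[{poly F}]_2) : C :=
  let g := K_repr X in
  iota (\det g) ^+ (n %% #|F|.-1) / autom g z ^+ w * (goss n).[t_A (moebius g z)].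

Definition poincare (w n : nat) (z : C) : C := usum KG (poincare_term w n z).

Definition rho_term (k : nat) (z : C) g : C :=
  iota (\det g) ^+ k / (numer g z ^+ k * autom g z ^+ k).

Definition rho (k : nat) (z : C) : C := usum GL2A (rho_term k z).

Definition deriv_at (phi : C -> C) (z : C) : C :=
  lim ((fun h => (phi (z + h) - phi z) / h) @ 0^').

(* Pullback of f(z) (dz)^k, such a form being given by its coefficient f. *)
Definition pullback (k : nat) (phi f : C -> C) (z : C) : C :=
  f (phi z) * deriv_at phi z ^+ k.

(* s(z; oo, 0) = dz / z *)
Definition s_infty_0 (z : C) : C := z^-1.

End Drinfeld.

(* Main.v *)
(* Writing the elements of a coset Kg as h = [u, -ub; 0, 1] g with u in F_q^*
   and b in A, the summand of rho at h is det(g)^k j_g(z)^(-2k) (gz - b)^(-k), which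
   does not depend on u. Summing over b gives the k-th Goss polynomial at
   t_A(gz), and summing over u multiplies the result by q - 1 = -1. The
   rearrangement is legitimate because, in a complete ultrametric field, a
   family tending to 0 is unconditionally summable, in any grouping. The summands tend
   to 0 because z is at positive distance from the fraction field of A: rounding
   T^M z to polynomials would otherwise yield an expansion of z in F_q((1/T)).

   Goss polynomials exist because the exponential function e of the finite
   lattice of polynomials of degree < d is periodic, so that
   e(z) = e(z - b) = sum_j a_j (z - b)^j for all b in the lattice. Multiplied by
   (z - b)^(-n) and summed over b, this is a recursion between the power sums
   S_n = sum_b (z - b)^(-n); its terms with j >= n vanish for n >= 2 by Lagrange
   interpolation, which also gives e(z) S_1 = 1. One then lets d tend to
   infinity. *)

Require Import Defs.
From mathcomp Require Import all_boot all_order all_algebra finmap.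
From mathcomp Require Import boolp classical_sets functions reals topology.
From mathcomp Require Import metric_structure sequences.
From mathcomp Require Import cardinality ring finfield.
From mathcomp Require summability.

Set Implicit Arguments.
Unset Strict Implicit.
Unset Printing Implicit Defensive.

Import Order.TTheory GRing.Theory Num.Theory.

Local Open Scope classical_set_scope.
Local Open Scope ring_scope.
#[local] Existing Instance summability.totally_filter.

(** * Ultrametric fields *)

Section UltrametricField.
Context {R : realType} {C : completeUltrametricFieldType R}.
Implicit Types (x y z : C) (e : R).

Lemma vabs_ge0 x : 0 <= vabs x.
Proof. exact: mdist_ge0. Qed.

Lemma mdistE x y : mdist x y = vabs (x - y).
Proof. by rewrite /vabs -(subrr y) -[in LHS](mdistDr _ _ (- y)). Qed.

Lemma vabs0 : vabs (0 : C) = 0.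
Proof. exact: mdistxx. Qed.

Lemma vabs_gt0 x : (0 < vabs x) = (x != 0).
Proof. exact: mdist_gt0. Qed.

Lemma vabs_eq0 x : (vabs x == 0) = (x == 0).
Proof. by apply/negb_inj; rewrite -vabs_gt0 lt0r vabs_ge0 andbT. Qed.

Lemma vabsM x y : vabs (x * y) = vabs x * vabs y.
Proof. exact: mdistM0. Qed.

Lemma vabs1 : vabs (1 : C) = 1.
Proof.
have n0 : vabs (1 : C) != 0 by rewrite vabs_eq0 oner_eq0.
by apply: (mulfI n0); rewrite -vabsM !mulr1.
Qed.

Lemma vabsX n x : vabs (x ^+ n) = vabs x ^+ n.
Proof. by elim: n => [|n IH]; rewrite ?expr0 ?vabs1// !exprS vabsM IH. Qed.

Lemma vabsN x : vabs (- x) = vabs x.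
Proof. by rewrite -sub0r -mdistE metric_sym. Qed.

Lemma vabsV x : vabs x^-1 = (vabs x)^-1.
Proof.
have [->|x0] := eqVneq x 0; first by rewrite invr0 vabs0 invr0.
have v0 : vabs x != 0 by rewrite vabs_eq0.
by apply: (mulfI v0); rewrite -vabsM !divff// vabs1.
Qed.

Lemma vabs_distC x y : vabs (x - y) = vabs (y - x).
Proof. by rewrite -mdistE metric_sym mdistE. Qed.

Lemma vabsD x y : vabs (x + y) <= Num.max (vabs x) (vabs y).
Proof.
by have := mdist_ultra (x + y) y 0; rewrite !mdistE addrK !subr0.
Qed.

Lemma vabsD_le e x y : vabs x <= e -> vabs y <= e -> vabs (x + y) <= e.
Proof. by move=> xe ye; rewrite (le_trans (vabsD _ _))// ge_max xe. Qed.

Lemma vabsD_lt e x y : vabs x < e -> vabs y < e -> vabs (x + y) < e.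
Proof. by move=> xe ye; rewrite (le_lt_trans (vabsD _ _))// gt_max xe. Qed.

Lemma vabsB_lt e x y : vabs x < e -> vabs y < e -> vabs (x - y) < e.
Proof. by move=> xe ye; rewrite vabsD_lt ?vabsN. Qed.

(** Otherwise [x] would be the difference of [x + y] and [y], both smaller than [x]. *)
Lemma vabsD_dominant x y : vabs y < vabs x -> vabs (x + y) = vabs x.
Proof.
move=> yx; apply/eqP; rewrite eq_le vabsD_le ?(ltW yx)//= leNgt.
apply/negP => xyx; have := vabsB_lt xyx yx.
by rewrite addrK ltxx.
Qed.

Lemma vabs_sum_lt (I : Type) (r : seq I) (P : pred I) (f : I -> C) e :
  0 < e -> (forall i, P i -> vabs (f i) < e) ->
  vabs (\sum_(i <- r | P i) f i) < e.
Proof.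
by move=> e0 fe; elim/big_ind: _ => //; [rewrite vabs0 | exact: vabsD_lt].
Qed.

Section Limits.
Context {T : Type} {G : set_system T} {FG : Filter G}.
Implicit Types f g : T -> C.

Lemma cvg_vabsP f x :
  f @ G --> x <-> forall e, 0 < e -> \forall t \near G, vabs (f t - x) < e.
Proof.
split=> [/cvg_ballP fx e e0|fx].
- by apply: filterS (fx e e0) => t; rewrite ballEmdist /= metric_sym mdistE.
- apply/cvg_ballP => e e0; apply: filterS (fx e e0) => t.
  by rewrite ballEmdist /= metric_sym mdistE.
Qed.

Lemma vcvgD f g x y :
  f @ G --> x -> g @ G --> y -> (fun t => f t + g t) @ G --> x + y.
Proof.
move=> /cvg_vabsP fx /cvg_vabsP gy; apply/cvg_vabsP => e e0.
apply: filterS2 (fx e e0) (gy e e0) => t fe ge.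
by rewrite opprD addrACA vabsD_lt.
Qed.

Lemma vcvg_bounded f x : f @ G --> x ->
  \forall t \near G, vabs (f t) < vabs x + 1.
Proof.
move=> /cvg_vabsP /(_ (vabs x + 1)); rewrite ltr_wpDl ?vabs_ge0// => /(_ isT).
apply: filterS => t fx; rewrite -[f t](subrK x) vabsD_lt// ltrDl.
exact: ltr01.
Qed.

Lemma vcvgM f g x y :
  f @ G --> x -> g @ G --> y -> (fun t => f t * g t) @ G --> x * y.
Proof.
move=> fx gy; have fb := vcvg_bounded fx.
move/cvg_vabsP : fx => fx; move/cvg_vabsP : gy => gy.
apply/cvg_vabsP => e e0.
have x1 : 0 < vabs x + 1 by rewrite ltr_wpDl ?vabs_ge0.
have y1 : 0 < vabs y + 1 by rewrite ltr_wpDl ?vabs_ge0.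
apply: filterS3 fb (fx _ (divr_gt0 e0 y1)) (gy _ (divr_gt0 e0 x1)).
move=> t fb fe ge.
have -> : f t * g t - x * y = f t * (g t - y) + (f t - x) * y.
  by rewrite mulrBr mulrBl addrA subrK.
rewrite vabsD_lt// vabsM.
  rewrite (le_lt_trans (ler_wpM2l (vabs_ge0 _) (ltW ge)))//.
  by rewrite mulrA ltr_pdivrMr// mulrC ltr_pM2l.
rewrite ltr_pdivlMr// in fe; rewrite (le_lt_trans _ fe)//.
by rewrite ler_wpM2l ?vabs_ge0// lerDl.
Qed.

Lemma vcvg_cst x : (fun=> x : C) @ G --> x.
Proof. exact: cvg_cst. Qed.

Lemma vcvgMl a f x : f @ G --> x -> (fun t => a * f t) @ G --> a * x.
Proof. exact/vcvgM/vcvg_cst. Qed.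

Lemma vcvgN f x : f @ G --> x -> (fun t => - f t) @ G --> - x.
Proof.
move=> fx; rewrite -mulN1r.
rewrite (_ : (fun t => _) = (fun t => -1 * f t)); first exact: vcvgMl.
by apply/funext => t; rewrite mulN1r.
Qed.

Lemma vcvgB f g x y :
  f @ G --> x -> g @ G --> y -> (fun t => f t - g t) @ G --> x - y.
Proof. by move=> fx gy; apply: vcvgD => //; exact: vcvgN. Qed.

Lemma vcvg_sum (I : Type) (r : seq I) (P : pred I) (f : I -> T -> C)
    (l : I -> C) :
  (forall i, P i -> f i @ G --> l i) ->
  (fun t => \sum_(i <- r | P i) f i t) @ G --> \sum_(i <- r | P i) l i.
Proof.
move=> fl; elim: r => [|i r IH].
  rewrite big_nil (_ : (fun t => _) = (fun=> 0)); first exact: vcvg_cst.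
  by apply/funext => t; rewrite big_nil.
rewrite big_cons (_ : (fun t => _) = fun t => if P i then
    f i t + \sum_(j <- r | P j) f j t else \sum_(j <- r | P j) f j t).
  by case: ifPn => Pi //; apply: vcvgD => //; exact: fl.
by apply/funext => t; rewrite big_cons.
Qed.

(** Away from 0 the absolute value is locally constant, by [vabsD_dominant]. *)
Lemma vcvg_near0 f x : x != 0 -> f @ G --> x ->
  \forall t \near G, vabs (f t) = vabs x.
Proof.
rewrite -vabs_gt0 => x0 /cvg_vabsP/(_ _ x0); apply: filterS => t ft.
by rewrite -[f t](subrKC x) vabsD_dominant.
Qed.

Lemma vcvgV f x : x != 0 -> f @ G --> x -> (fun t => (f t)^-1) @ G --> x^-1.
Proof.
move=> x0 fx; have fn := vcvg_near0 x0 fx; move/cvg_vabsP : fx => fx.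
apply/cvg_vabsP => e e0.
have vx0 : 0 < vabs x by rewrite vabs_gt0.
have := fx (e * vabs x ^+ 2); rewrite mulr_gt0 ?exprn_gt0// => /(_ isT).
apply: filterS2 fn => t ft fxt.
have ft0 : f t != 0 by rewrite -vabs_gt0 ft.
have -> : (f t)^-1 - x^-1 = (x - f t) / (f t * x).
  by rewrite mulrBl invfM mulrCA divff// mulr1 mulVKf.
by rewrite vabsM vabsV vabsM ft -expr2 ltr_pdivrMr ?exprn_gt0// vabs_distC.
Qed.

End Limits.

Lemma vcvg_unique (T : Type) (G : set_system T) {FG : ProperFilter G}
    (f : T -> C) x y : f @ G --> x -> f @ G --> y -> x = y.
Proof. exact/cvg_unique/metric_hausdorff. Qed.

Lemma vlimP (T : Type) (G : set_system T) {FG : ProperFilter G}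
    (f : T -> C) x : f @ G --> x -> lim (f @ G) = x.
Proof. exact/cvg_lim/metric_hausdorff. Qed.

End UltrametricField.

(** * Unordered sums and products *)

Lemma big_fsubset (S : Type) (idx : S) (op : Monoid.com_law idx)
    (I : choiceType) (A B : {fset I}) (P : pred I) (f : I -> S) :
  (A `<=` B)%fset ->
  \big[op/idx]_(i <- B | P i) f i =
  op (\big[op/idx]_(i <- A | P i) f i)
     (\big[op/idx]_(i <- B | P i && (i \notin A)) f i).
Proof.
move=> /fsubsetP AB; rewrite (bigID (mem A)) /=; congr (op _ _).
rewrite -[in LHS]big_filter -[in RHS]big_filter; apply: perm_big.
apply: uniq_perm; rewrite ?filter_uniq ?fset_uniq// => i.
rewrite !mem_filter andbAC -andbA; congr (_ && _).
by apply/andP/idP => [[]//|iA]; rewrite iA AB.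
Qed.

Lemma ord2_ind (P : 'I_2 -> Prop) : P 0 -> P 1 -> forall i, P i.
Proof.
move=> P0 P1 [[|[|//]] i2].
- by rewrite (_ : Ordinal _ = 0)//; exact/val_inj.
- by rewrite (_ : Ordinal _ = 1)//; exact/val_inj.
Qed.

Lemma det_mx2 (S : comNzRingType) (A : 'M[S]_2) :
  \det A = A 0 0 * A 1 1 - A 0 1 * A 1 0.
Proof.
rewrite (expand_det_row _ 0) !big_ord_recl big_ord0 /cofactor !det_mx11 !mxE.
rewrite /= addr0 expr0 expr1 mul1r mulN1r mulrN.
by congr (A _ _ * A _ _ - A _ _ * A _ _); exact/val_inj.
Qed.

Section UnorderedSums.
Context {R : realType} {C : completeUltrametricFieldType R}.

(** Convergence to 0 along the cofinite filter of [D], which in a complete ultrametric field is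
    enough for unordered summability. *)
Definition vanishing (I : choiceType) (D : set I) (f : I -> C) :=
  forall e : R, 0 < e -> finite_set [set i | D i /\ e <= vabs (f i)].

Lemma vanishing_fset (I : choiceType) (D : set I) (f : I -> C) (e : R) :
  vanishing D f -> 0 < e ->
  exists S : {fset I}, forall i, D i -> i \notin S -> vabs (f i) < e.
Proof.
move=> fv /fv /finite_fsetP [S DS]; exists S => i Di iS.
rewrite ltNge; apply/negP => ei; move/negP: iS; apply.
by have : [set` S] i by rewrite -DS.
Qed.

Lemma vanishing_sub (I : choiceType) (D E : set I) (f : I -> C) :
  D `<=` E -> vanishing E f -> vanishing D f.
Proof.
move=> DE fE e /fE; apply: sub_finite_set => i [Di ei]; split => //.
exact: DE.
Qed.

(** Ultrametric tail estimate: some partial sum over a finite superset of [S] is within [e] of [s],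
    and the terms it adds to those of [S] are all smaller than [e]. *)
Lemma usums_vabs_lt (I : choiceType) (D : set I) (f : I -> C) (S : {fset I})
    (e : R) (s : C) : 0 < e ->
  (forall i, D i -> i \notin S -> vabs (f i) < e) -> usums D f --> s ->
  vabs (s - \sum_(i <- S | i \in D) f i) < e.
Proof.
move=> e0 fe /cvg_vabsP/(_ _ e0) [S1 _ /(_ (S1 `|` S)%fset)].
move=> /(_ (fsubsetUl _ _)); rewrite vabs_distC => sS.
rewrite -(subrK (\sum_(i <- (S1 `|` S)%fset | i \in D) f i) s) -addrA.
rewrite vabsD_lt// (big_fsubset _ _ _ (fsubsetUr S1 S)) addrC addKr.
by apply: vabs_sum_lt => // i /andP[/set_mem Di]; exact: fe.
Qed.

Lemma vanishing_usummable (I : choiceType) (D : set I) (f : I -> C) :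
  vanishing D f -> usummable D f.
Proof.
move=> fv; apply/cauchy_cvgP/cauchy_exP => e e0.
have [S Se] := vanishing_fset fv e0.
exists (\sum_(i <- S | i \in D) f i), S => // S' /= SS'.
rewrite ballEmdist /= metric_sym mdistE (big_fsubset _ _ _ SS') addrC addKr.
by apply: vabs_sum_lt => // i /andP[/set_mem Di]; exact: Se.
Qed.

Lemma eq_usums (I : choiceType) (D : set I) (f g : I -> C) :
  (forall i, D i -> f i = g i) -> usums D f = usums D g.
Proof.
move=> fg; rewrite /usums.
suff -> : (fun S : {fset I} => \sum_(i <- S | i \in D) f i) =
    (fun S : {fset I} => \sum_(i <- S | i \in D) g i) by [].
by apply/funext => S; apply: eq_bigr => i /set_mem; exact: fg.
Qed.

Lemma eq_usum (I : choiceType) (D : set I) (f g : I -> C) :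
  (forall i, D i -> f i = g i) -> usum D f = usum D g.
Proof. by move=> fg; rewrite /usum (eq_usums fg). Qed.

Lemma usums_finite (I : choiceType) (D : set I) (S : {fset I}) (f : I -> C) :
  (forall i, D i <-> i \in S) -> usums D f --> \sum_(i <- S) f i.
Proof.
move=> DS; apply/cvg_vabsP => e e0; exists S => // S' /= SS'.
rewrite (big_fsubset _ _ _ SS') [X in _ + X - _]big1 => [|i]; last first.
  by case/andP => /set_mem /DS ->.
rewrite addr0 big_seq_cond [X in _ - X]big_seq.
rewrite (eq_bigl (fun i => i \in S)) ?subrr ?vabs0// => i.
by case: (boolP (i \in S)) => // /DS /mem_set ->.
Qed.

Lemma usumsMl (I : choiceType) (D : set I) (f : I -> C) (a s : C) :
  usums D f --> s -> usums D (fun i => a * f i) --> a * s.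
Proof.
move=> fs; rewrite /usums.
suff -> : (fun S : {fset I} => \sum_(i <- S | i \in D) a * f i) =
    (fun S : {fset I} => a * \sum_(i <- S | i \in D) f i) by exact: vcvgMl.
by apply/funext => S; rewrite mulr_sumr.
Qed.

(** Choose a finite [S] off which [f] is smaller than [e]. Once [T] contains the image of [S], the
    sum of [g] over [T] differs from the sum of [f] over [S] only by tails of fibre sums, and
    [usums_vabs_lt] bounds each of these as well as the error of [S]. *)
Lemma usums_fibers (I J : choiceType) (D : set I) (h : I -> J)
    (f : I -> C) (g : J -> C) (s : C) :
  vanishing D f -> usums D f --> s ->
  (forall j, (h @` D) j -> usums [set i | D i /\ h i = j] f --> g j) ->
  usums (h @` D) g --> s.
Proof.
move=> fv fs fg; apply/cvg_vabsP => e e0.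
have [S Se] := vanishing_fset fv e0.
exists [fset h i | i in S]%fset => // T /fsubsetP hST.
have := usums_vabs_lt e0 Se fs; rewrite vabs_distC => sS.
rewrite -(subrK (\sum_(i <- S | i \in D) f i) (\sum_(j <- T | _) _)) -addrA.
rewrite vabsD_lt//.
(* Every index of [S] in [D] lies in exactly one fibre, the one over [h i], and [T] contains
   [h i]. *)
have -> : \sum_(i <- S | i \in D) f i = \sum_(j <- T | j \in h @` D)
    \sum_(i <- S | i \in [set i | D i /\ h i = j]) f i.
  rewrite (exchange_big_dep (mem D)) /=; last first.
    by move=> j i _ /set_mem [/mem_set].
  rewrite big_seq_cond [RHS]big_seq_cond; apply: eq_bigr => i /andP[iS iD].
  rewrite -big_filter (_ : [seq _ <- _ | _] = [:: h i]) ?big_seq1//.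
  have -> : [seq j <- T | (j \in h @` D) && (i \in [set i | D i /\ h i = j])] =
      [seq j <- T | j == h i].
    apply: eq_filter => j; apply/andP/eqP => [[_ /set_mem[_ ->]]//|->].
    by split; apply/mem_set; [exists i => //|split => //]; exact/set_mem.
  apply: filter_pred1_uniq; first exact: fset_uniq.
  by apply: hST; apply/imfsetP; exists i.
rewrite -sumrB; apply: vabs_sum_lt => // j /set_mem jD.
apply: usums_vabs_lt (fg _ jD) => // i [Di _]; exact: Se.
Qed.

Lemma vanishing_inj (I J : choiceType) (D : set I) (h : I -> J)
    (f : J -> C) : {in D &, injective h} ->
  vanishing (h @` D) f -> vanishing D (f \o h).
Proof.
move=> hi fv e /fv fe.
set X := (X in finite_set X).
have XD : X `<=` D by move=> i [].
rewrite -(eq_finite_set (inj_card_eq (f := h) (A := X) _)); last first.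
  move=> x y /set_mem/XD Dx /set_mem/XD Dy; apply: hi; exact/mem_set.
by apply: sub_finite_set fe => _ [i [Di ei] <-]; split => //; exists i.
Qed.

Lemma usums_inj (I J : choiceType) (D : set I) (h : I -> J)
    (f : J -> C) (s : C) : {in D &, injective h} ->
  vanishing (h @` D) f ->
  usums D (f \o h) --> s -> usums (h @` D) f --> s.
Proof.
move=> hi /(vanishing_inj hi) fv fs; apply: usums_fibers fv fs _ => j [i Di <-].
rewrite -[f (h i)](big_seq_fset1 +%R i (f \o h)).
apply: usums_finite => k; rewrite inE; split => [[Dk]|/eqP ->//].
by move/hi => -> //; exact/mem_set.
Qed.

End UnorderedSums.
(** * Exponential functions of finite lattices *)

Section TranslationInvariantRoots.
Context {K : fieldType} (s : seq K).
Hypothesis s_uniq : uniq s.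
Hypothesis s0 : 0 \in s.
Hypothesis sB : {in s &, forall x y, x - y \in s}.

(** The derivative at 0 of the product of all ['X - c%:P]. By translation invariance it is the
    derivative at every element of [s], so all Lagrange denominators coincide. *)
Let kappa := \prod_(c <- s | c != 0) - c.

Definition lattice_exp : {poly K} := kappa^-1 *: \prod_(c <- s) ('X - c%:P).

Lemma perm_translate b : b \in s -> perm_eq [seq x - b | x <- s] s.
Proof.
move=> bs; have us : uniq [seq x - b | x <- s].
  by rewrite map_inj_uniq//; exact: addIr.
apply: uniq_perm => //; have [||_ //] := @uniq_min_size _ _ s us.
  by move=> _ /mapP[y ys ->]; exact: sB.
by rewrite size_map.
Qed.

Lemma kappa_neq0 : kappa != 0.
Proof.
by rewrite prodf_seq_neq0; apply/allP => c _; apply/implyP; rewrite oppr_eq0.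
Qed.

Lemma prod_diff_const b : b \in s -> \prod_(c <- s | c != b) (b - c) = kappa.
Proof.
move=> bs; rewrite /kappa -[RHS](perm_big _ (perm_translate bs)) /= big_map.
by apply: eq_big => [c|c _]; rewrite ?subr_eq0 ?opprB.
Qed.

(** Both sides have degree less than the cardinality of [s] and agree on [s]: at a point of [s] only
    one product survives, and it equals [kappa] by [prod_diff_const]. *)
Lemma lagrange_interpolation (f : {poly K}) : (size f <= size s)%N ->
  \sum_(b <- s) f.[b] *: \prod_(c <- s | c != b) ('X - c%:P) = kappa *: f.
Proof.
move=> fs; apply/eqP; rewrite -subr_eq0; apply/eqP.
apply: (roots_geq_poly_eq0 (rs := s)) => //.
  apply/allP => b0 b0s; rewrite /root hornerD hornerN hornerZ horner_sum.
  rewrite (bigD1_seq b0) //= [X in _ + X - _]big1_seq ?addr0;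
    last move=> b /andP[b0b bs].
    rewrite hornerZ horner_prod; under eq_bigr do rewrite hornerXsubC.
    by rewrite prod_diff_const// mulrC subrr.
  rewrite hornerZ horner_prod; apply/eqP; rewrite mulf_eq0; apply/orP; right.
  rewrite prodf_seq_eq0; apply/hasP; exists b0 => //.
  by rewrite eq_sym b0b hornerXsubC subrr eqxx.
rewrite (leq_trans (size_polyD _ _))// geq_max; apply/andP; split.
  rewrite (leq_trans (size_sum _ _ _))//; apply/bigmax_leqP_seq => b bs _.
  rewrite (leq_trans (size_scale_leq _ _))// -big_filter size_prod_XsubC.
  rewrite size_filter -(count_predC (pred1 b) s).
  by rewrite (count_uniq_mem _ s_uniq) bs.
by rewrite size_polyN (leq_trans (size_scale_leq _ _)).
Qed.

(** Compare the coefficients of degree [(size s).-1] in the interpolation formula: the products are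
    monic of that degree, and [f] has smaller degree. *)
Lemma sum_poly_lattice_eq0 (f : {poly K}) : (size f < size s)%N ->
  \sum_(b <- s) f.[b] = 0.
Proof.
move=> fs; have := lagrange_interpolation (ltnW fs).
move=> /(congr1 (coefp (size s).-1)); rewrite /= coefZ coef_sum.
have -> : f`_(size s).-1 = 0 by apply: nth_default; case: (size s) fs.
rewrite mulr0 => fE; rewrite -[RHS]fE; rewrite big_seq [RHS]big_seq.
apply: eq_bigr => b bs; rewrite coefZ -big_filter.
set r := [seq c <- s | c != b].
have -> : (size s).-1 = (size (\prod_(c <- r) ('X - c%:P))).-1.
  rewrite size_prod_XsubC size_filter /= -(count_predC (pred1 b) s).
  by rewrite (count_uniq_mem _ s_uniq) bs.
have /monicP := monic_prod_XsubC r predT id.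
by rewrite lead_coefE => ->; rewrite mulr1.
Qed.

Lemma horner_lattice_exp z :
  lattice_exp.[z] = z * \prod_(c <- s | c != 0) (1 - z / c).
Proof.
rewrite hornerZ horner_prod (bigD1_seq 0)//= hornerXsubC subr0 mulrCA.
congr (_ * _); rewrite /kappa -prodfV -big_split /=.
apply: eq_bigr => c c0.
by rewrite hornerXsubC mulrC mulrBl !invrN !mulrN divff// opprK addrC.
Qed.

Lemma lattice_exp_periodic z b : b \in s ->
  lattice_exp.[z - b] = lattice_exp.[z].
Proof.
move=> bs; rewrite !hornerZ !horner_prod; congr (_ * _).
have Nbs : - b \in s by rewrite -sub0r sB.
rewrite -[RHS](perm_big _ (perm_translate Nbs)) /= big_map.
by apply: eq_bigr => c _; rewrite !hornerXsubC opprK opprD addrA addrAC.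
Qed.

Lemma lattice_exp_coef0 : lattice_exp`_0 = 0.
Proof. by rewrite -horner_coef0 horner_lattice_exp mul0r. Qed.

Lemma size_lattice_exp : (size lattice_exp <= (size s).+1)%N.
Proof. by rewrite (leq_trans (size_scale_leq _ _))// size_prod_XsubC. Qed.

Variable z : K.
Hypothesis zs : z \notin s.

Let zB_neq0 b : b \in s -> z - b != 0.
Proof. by move=> bs; apply: contraNneq zs => /subr0_eq ->. Qed.

(** Interpolating the constant 1 and evaluating at [z] gives [kappa] as the sum of the products that
    omit one factor [z - b]. *)
Lemma lattice_exp_sum1 :
  lattice_exp.[z] * \sum_(b <- s) (z - b) ^- 1 = 1.
Proof.
have s1 : (size (1%R : {poly K}) <= size s)%N.
  by rewrite size_poly1; case: (s) s0.
have /(congr1 (horner^~ z)) := lagrange_interpolation s1.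
rewrite horner_sum hornerZ hornerC mulr1 => kE.
rewrite hornerZ -mulrA [X in _ * X](_ : _ = kappa) ?mulVf ?kappa_neq0//.
rewrite -kE mulr_sumr big_seq [RHS]big_seq; apply: eq_bigr => b bs.
rewrite hornerC scale1r !horner_prod (bigD1_seq b)//= hornerXsubC expr1.
by rewrite mulrAC divff ?mul1r// zB_neq0.
Qed.

Lemma lattice_exp_sumS n :
  lattice_exp.[z] * \sum_(b <- s) (z - b) ^- n.+2 =
  \sum_(i < n.+1) lattice_exp`_i.+1 * \sum_(b <- s) (z - b) ^- (n.+1 - i).
Proof.
rewrite mulr_sumr; under [RHS]eq_bigr do rewrite mulr_sumr.
rewrite [RHS]exchange_big /=; apply/eqP; rewrite -subr_eq0 -sumrB; apply/eqP.
(* As a polynomial in [b], this is the part of degree at least [n.+2] of [lattice_exp] at [z - b],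
   divided by [(z - b) ^+ n.+2]. Dropping at least two coefficients makes its size small enough for
   [sum_poly_lattice_eq0]. *)
pose f := drop_poly n.+2 lattice_exp \Po (z%:P - 'X).
have fs : (size f < size s)%N.
  have sX : size (z%:P - 'X)%R = 2%N.
    by rewrite -opprB size_polyN size_XsubC.
  rewrite size_comp_poly2// size_drop_poly.
  have := size_lattice_exp; case: (s) s0 => //= _ t _ ts.
  by rewrite ltnS leq_subLR (leq_trans ts)// !addSn !ltnS leq_addl.
rewrite -[RHS](sum_poly_lattice_eq0 fs) big_seq [RHS]big_seq.
apply: eq_bigr => b bs; have zb := zB_neq0 bs.
rewrite -(lattice_exp_periodic z bs) -[X in X.[_]](poly_take_drop n.+2).
rewrite hornerD hornerM hornerXn mulrDl mulfK ?expf_neq0//.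
rewrite horner_comp hornerD hornerN hornerC hornerX.
apply/eqP; rewrite addrAC -subr_eq0 addrK subr_eq0 /take_poly horner_poly.
rewrite big_ord_recl lattice_exp_coef0 mul0r add0r mulr_suml.
apply/eqP; apply: eq_bigr => i _; rewrite lift0 -mulrA; congr (_ * _).
apply: (mulIf (expf_neq0 n.+2 zb)); rewrite mulfVK ?expf_neq0//.
apply: (mulIf (expf_neq0 (n.+1 - i) zb)).
by rewrite mulrAC mulVf ?expf_neq0// mul1r -exprD addSn subnKC// ltnW.
Qed.

End TranslationInvariantRoots.

(** * Infinite products with factors tending to 1 *)

Section UnorderedProducts.
Context {R : realType} {C : completeUltrametricFieldType R}.

(** For [e <= 1] the open ball of radius [e] around 1 is closed under products, as xy - 1 = (x -
    1)(y - 1) + (x - 1) + (y - 1). *)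
Lemma vabs_prod_sub1_lt (I : Type) (r : seq I) (P : pred I) (g : I -> C)
    (e : R) : 0 < e -> e <= 1 -> (forall i, P i -> vabs (g i) < e) ->
  vabs (\prod_(i <- r | P i) (1 - g i) - 1) < e.
Proof.
move=> e0 e1 ge; elim/big_ind: _ => [|x y xe ye|i Pi].
- by rewrite subrr vabs0.
- have -> : x * y - 1 = (x - 1) * (y - 1) + ((x - 1) + (y - 1)).
    by rewrite mulrBr mulr1 mulrBl mul1r addrA subrK addrA subrK.
  rewrite vabsD_lt//; last exact: vabsD_lt.
  rewrite vabsM (le_lt_trans _ xe)// ler_piMr ?vabs_ge0//.
  by rewrite (le_trans (ltW ye)).
- by rewrite addrC addKr vabsN ge.
Qed.

(** Outside a finite set [S1] the factors are at distance less than 1 from 1, so they have absolute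
    value 1. The partial products thus have an eventually constant nonzero absolute value, which
    scales the Cauchy estimate and excludes the limit 0. *)
Lemma uprod_cvg (I : choiceType) (D : set I) (g : I -> C) :
  vanishing D g -> (forall i, D i -> g i != 1) ->
  uprod D (fun i => 1 - g i) != 0 /\
  (fun S : {fset I} => \prod_(i <- S | i \in D) (1 - g i))
    @ summability.totally --> uprod D (fun i => 1 - g i).
Proof.
move=> gv g1; pose p (S : {fset I}) := \prod_(i <- S | i \in D) (1 - g i).
have [S1 S1g] := vanishing_fset gv ltr01.
have p0 : 0 < vabs (p S1).
  rewrite vabs_gt0 prodf_seq_neq0; apply/allP => i _; apply/implyP.
  by move=> /set_mem Di; rewrite subr_eq0 eq_sym g1.
have pE (S : {fset I}) : (S1 `<=` S)%fset -> vabs (p S) = vabs (p S1).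
  move=> SS; rewrite /p (big_fsubset _ _ _ SS) vabsM -[RHS]mulr1.
  congr (_ * _); rewrite -[X in vabs X](subrKC 1) vabsD_dominant ?vabs1//.
  by apply: vabs_prod_sub1_lt => // i /andP[/set_mem Di]; exact: S1g.
have pc : cvg (p @ summability.totally).
  apply/cauchy_cvgP/cauchy_exP => e e0.
  pose e' := Num.min 1 (e / vabs (p S1)).
  have e'0 : 0 < e' by rewrite lt_min ltr01 divr_gt0.
  have [S2 S2g] := vanishing_fset gv e'0.
  exists (p (S1 `|` S2)%fset), (S1 `|` S2)%fset => // S /= SS.
  rewrite ballEmdist /= metric_sym mdistE {1}/p (big_fsubset _ _ _ SS).
  rewrite -/(p _) -[X in _ - X]mulr1 -mulrBr vabsM pE ?fsubsetUl//.
  rewrite mulrC -ltr_pdivlMr// (lt_le_trans (y := e'))//; last first.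
    by rewrite ge_min lexx orbT.
  apply: vabs_prod_sub1_lt => //; first by rewrite ge_min lexx.
  move=> i /andP[/set_mem Di]; rewrite inE negb_or => /andP[_ iS2].
  exact: S2g.
split; last exact: pc.
apply/eqP => l0; move/cvg_ballP : pc => /(_ _ p0) [S _].
rewrite -/(uprod _ _) l0 => /(_ (S1 `|` S)%fset (fsubsetUr _ _)).
by rewrite ballEmdist /= metric_sym mdistE subr0 pE ?fsubsetUl// ltxx.
Qed.

End UnorderedProducts.
(** * Eisenstein series and Goss polynomials *)

Section FunctionField.
Context {R : realType} {F : finFieldType} {C : completeUltrametricFieldType R}.
Variable iota : {rmorphism {poly F} -> C}.
Hypothesis iota_abs : forall a : {poly F},
  a != 0 -> vabs (iota a) = #|F|%:R ^+ (size a).-1.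

Lemma iota_neq0 (a : {poly F}) : a != 0 -> iota a != 0.
Proof.
move=> a0; rewrite -vabs_gt0 iota_abs// exprn_gt0// ltr0n.
by apply/card_gt0P; exists 0.
Qed.

Lemma iota_inj : injective iota.
Proof.
move=> a b /eqP; rewrite -subr_eq0 -rmorphB => ab; apply/eqP.
by rewrite -subr_eq0; apply: contraTT ab; exact: iota_neq0.
Qed.

Lemma iota_vabs_ge1 (a : {poly F}) : a != 0 -> 1 <= vabs (iota a).
Proof.
move=> a0; rewrite iota_abs// exprn_ege1// ler1n.
by apply/card_gt0P; exists 0.
Qed.

Lemma iota_vabs_size (a b : {poly F}) : b != 0 -> (size a < size b)%N ->
  vabs (iota a) < vabs (iota b).
Proof.
move=> b0 ab; rewrite [X in _ < X]iota_abs//.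
have q1 : 1 < #|F|%:R :> R by rewrite ltr1n card_finNzRing_gt1.
have [->|a0] := eqVneq a 0.
  by rewrite rmorph0 vabs0 exprn_gt0// (lt_trans ltr01).
rewrite iota_abs// ltr_eXn2l//.
by move: ab a0 b0; rewrite -!size_poly_gt0; case: (size a) (size b) => [|?] [].
Qed.

Definition polys (d : nat) : {fset {poly F}} :=
  [fset rVpoly v | v in [set: 'rV[F]_d]%SET]%fset.

Lemma mem_polys d b : (b \in polys d) = (size b <= d)%N.
Proof.
apply/imfsetP/idP => [[v _ ->]|bd]; first exact: size_poly.
by exists (poly_rV b); rewrite ?inE// poly_rV_K.
Qed.

Lemma size_bounded (B : R) :
  exists d, forall b, vabs (iota b) < B -> (size b <= d)%N.
Proof.
exists (Num.truncn B).+2 => b; apply: contraTT; rewrite -ltnNge -leNgt => db.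
have b0 : b != 0 by rewrite -size_poly_gt0 (leq_trans _ db).
rewrite iota_abs// -natrX (le_trans (ltW (truncnS_gt _)))// ler_nat.
have q1 := card_finNzRing_gt1 F.
rewrite (leq_trans (ltnW (ltn_expl _ q1)))// leq_exp2l//.
by case: (size b) db => // n; rewrite /= ltnS => /ltnW.
Qed.

Lemma bounded_polys_finite (D : set {poly F}) (B : R) :
  (forall b, D b -> vabs (iota b) < B) -> finite_set D.
Proof.
move=> DB; have [d Bd] := size_bounded B.
by apply: (finite_subfset (polys d)) => b /DB /Bd; rewrite -mem_polys.
Qed.

(** The sets [polys d] are cofinal among the finite sets of polynomials, so unordered limits over A
    can be computed as limits in [d]. *)
Lemma polys_totally : polys d @[d --> \oo] --> summability.totally.
Proof.
move=> P [S _ SP]; have [n Sn] : exists n, forall b, b \in S -> (size b <= n)%N.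
  exists (\max_(b <- S) size b)%N => b bS; exact: leq_bigmax_seq.
exists n => // d /= nd; apply: SP; apply/fsubsetP => b bS.
by rewrite mem_polys (leq_trans (Sn _ bS)).
Qed.

Definition lattice d : seq C := map iota (polys d).

Lemma lattice_uniq d : uniq (lattice d).
Proof. by rewrite map_inj_uniq ?fset_uniq//; exact: iota_inj. Qed.

Lemma lattice0 d : 0 \in lattice d.
Proof. by rewrite -(rmorph0 iota) map_f// mem_polys size_poly0. Qed.

Lemma latticeB d : {in lattice d &, forall x y, x - y \in lattice d}.
Proof.
move=> _ _ /mapP[a + ->] /mapP[b + ->]; rewrite !mem_polys => ad bd.
rewrite -rmorphB map_f// mem_polys (leq_trans (size_polyD _ _))//.
by rewrite size_polyN geq_max ad.
Qed.

Lemma notin_lattice z d : ~ range iota z -> z \notin lattice d.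
Proof. by move=> zA; apply/mapP => -[b _ zb]; apply: zA; exists b. Qed.

Definition eisenstein (n : nat) (z : C) : C :=
  usum setT (fun b : {poly F} => (z - iota b) ^- n).

Lemma eisenstein_vanishing n z : ~ range iota z ->
  vanishing setT (fun b : {poly F} => (z - iota b) ^- n.+1).
Proof.
move=> zA e e0.
have [B [B1 Be]] : exists B : R, 1 <= B /\ e^-1 <= B.
  by exists (Num.max 1 e^-1); rewrite !le_max !lexx orbT.
apply: (@bounded_polys_finite _ (Num.max (vabs z) B + 1)) => b [_].
have zb : z - iota b != 0.
  by apply/eqP => /subr0_eq zb; apply: zA; exists b.
rewrite vabsV vabsX => ezb; rewrite -(subKr z (iota b)).
rewrite (le_lt_trans (y := Num.max (vabs z) B)) ?ltrDl//.
rewrite (le_trans (vabsD _ _))// vabsN ge_max !le_max lexx /=.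
apply/orP; right; rewrite leNgt; apply/negP => Bzb; move: ezb; apply/negP.
rewrite -ltNge invf_plt ?posrE ?exprn_gt0 ?vabs_gt0//.
rewrite (le_lt_trans Be)// (lt_le_trans Bzb)// ler_eXnr//.
by rewrite (le_trans B1)// ltW.
Qed.

Lemma eisenstein_cvg n z : ~ range iota z ->
  (fun d => \sum_(b <- lattice d) (z - b) ^- n.+1) @ \oo --> eisenstein n.+1 z.
Proof.
move=> zA; have := cvg_comp _ _ polys_totally
  (vanishing_usummable (eisenstein_vanishing n zA)).
suff -> : (fun d => \sum_(b <- lattice d) (z - b) ^- n.+1) =
    (fun S : {fset {poly F}} =>
       \sum_(b <- S | b \in setT) (z - iota b) ^- n.+1) \o polys by [].
by apply/funext => d; rewrite big_map; apply: eq_bigl => b; rewrite in_setT.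
Qed.

Lemma quotient_vanishing z :
  vanishing [set b : {poly F} | b != 0] (fun b => z / iota b).
Proof.
move=> e e0; apply: (@bounded_polys_finite _ (vabs z / e + 1)) => b [/= b0].
rewrite vabsM vabsV ler_pdivlMr ?vabs_gt0 ?iota_neq0// => ez.
by rewrite (le_lt_trans (y := vabs z / e)) ?ltrDl// ler_pdivlMr// mulrC.
Qed.

(** Since [z] is not in A, no factor [1 - z / iota b] vanishes and [uprod_cvg] applies; along
    [polys d] the partial products are the finite exponential functions. *)
Lemma e_A_cvg z : ~ range iota z ->
  e_A iota z != 0 /\
  (fun d => (lattice_exp (lattice d)).[z]) @ \oo --> e_A iota z.
Proof.
move=> zA.
have z1 (b : {poly F}) : b != 0 -> z / iota b != 1.
  move=> b0; apply/eqP => zb; apply: zA; exists b => //.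
  by rewrite -[RHS](divfK (iota_neq0 b0)) zb mul1r.
have [p0 pc] := uprod_cvg (@quotient_vanishing z) z1.
split.
  rewrite mulf_neq0//; apply/eqP => z0; apply: zA; exists 0 => //.
  by rewrite rmorph0.
have := vcvgMl (a := z) (cvg_comp _ _ polys_totally pc).
suff -> : (fun d => (lattice_exp (lattice d)).[z]) = (fun d => z *
    \prod_(b <- polys d | b \in [set b : {poly F} | b != 0]) (1 - z / iota b)).
  exact.
apply/funext => d; rewrite horner_lattice_exp ?lattice_uniq ?lattice0//.
rewrite big_map; congr (_ * _); apply: eq_bigl => b.
apply/idP/idP.
  by move=> ib; apply/mem_set; apply: contraNneq ib => ->; rewrite rmorph0.
by move=> /set_mem; exact: iota_neq0.
Qed.

Lemma eisenstein1 z : ~ range iota z -> e_A iota z * eisenstein 1 z = 1.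
Proof.
move=> zA; have [_ ec] := e_A_cvg zA.
apply: vcvg_unique (vcvgM ec (@eisenstein_cvg 0 z zA)) _.
rewrite (_ : (fun d => _) = fun=> 1); first exact: vcvg_cst.
apply/funext => d; apply: lattice_exp_sum1; first exact: lattice_uniq.
- exact: lattice0.
- exact: latticeB.
- exact: notin_lattice.
Qed.

Let lattice_recursion d n z : ~ range iota z ->
  (lattice_exp (lattice d)).[z] * \sum_(b <- lattice d) (z - b) ^- n.+2 =
  \sum_(i < n.+1) (lattice_exp (lattice d))`_i.+1 *
    \sum_(b <- lattice d) (z - b) ^- (n - i).+1.
Proof.
move=> zA; rewrite lattice_exp_sumS ?lattice_uniq ?lattice0//.
- by apply: eq_bigr => i _; rewrite subSn// -ltnS.
- exact: latticeB.
- exact: notin_lattice.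
Qed.

(* Solving the recursion between the power sums for its last coefficient, at a
   single point outside of A, expresses the coefficients of the exponential
   functions of the finite lattices through convergent sequences. *)
Lemma lattice_exp_coef_cvg z n : ~ range iota z ->
  cvg ((fun d => (lattice_exp (lattice d))`_n.+1) @ \oo).
Proof.
move=> zA; have [_ ec] := e_A_cvg zA.
elim/ltn_ind: n => n IH.
pose a d i := (lattice_exp (lattice d))`_i.+1.
pose G d i := \sum_(b <- lattice d) (z - b) ^- i.+1.
have aE d : a d n = (lattice_exp (lattice d)).[z] *
    ((lattice_exp (lattice d)).[z] * G d n.+1 -
     \sum_(i < n) a d i * G d (n - i)%N).
  rewrite /G lattice_recursion// big_ord_recr /= addrAC subrr add0r subnn.
  rewrite mulrCA lattice_exp_sum1 ?mulr1 ?lattice_uniq ?lattice0//.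
  - exact: latticeB.
  - exact: notin_lattice.
rewrite (_ : (fun d => _) = (fun d => (lattice_exp (lattice d)).[z] *
    ((lattice_exp (lattice d)).[z] * G d n.+1 -
     \sum_(i < n) a d i * G d (n - i)%N))); last exact/funext.
apply: cvgP; apply: (vcvgM ec); apply: vcvgB.
  exact: vcvgM ec (@eisenstein_cvg _ _ zA).
apply: vcvg_sum => i _; apply: vcvgM (@eisenstein_cvg _ _ zA).
exact: IH.
Qed.

(** These limits do not involve the point [z], so the recursion for the infinite lattice has
    constant coefficients and its solutions are polynomials in [t_A]. *)
Definition e_A_coef (n : nat) : C :=
  lim ((fun d => (lattice_exp (lattice d))`_n.+1) @ \oo).

Lemma eisenstein_recursion n z : ~ range iota z ->
  e_A iota z * eisenstein n.+2 z =
  \sum_(i < n.+1) e_A_coef i * eisenstein (n - i).+1 z.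
Proof.
move=> zA; have [_ ec] := e_A_cvg zA.
apply: vcvg_unique (vcvgM ec (@eisenstein_cvg n.+1 z zA)) _.
rewrite (_ : (fun d => _) = fun d => \sum_(i < n.+1)
    (lattice_exp (lattice d))`_i.+1 *
      \sum_(b <- lattice d) (z - b) ^- (n - i).+1); last first.
  by apply/funext => d; exact: lattice_recursion.
apply: vcvg_sum => i _; apply: vcvgM (@eisenstein_cvg _ _ zA).
exact: (@lattice_exp_coef_cvg z).
Qed.

(** Dividing the recursion by [e_A] gives G_(n+2) = X sum_i a_i G_(n+1-i) with a_i = [e_A_coef i],
    starting from G_1 = X. Here [p m] stands for the polynomial of index [m.+1]. *)
Lemma goss_exists n : exists p : nat -> {poly C}, forall m, (m < n)%N ->
  forall z, ~ range iota z -> eisenstein m.+1 z = (p m).[t_A iota z].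
Proof.
elim: n => [|n [p pE]]; first by exists (fun=> 0).
pose r := if n is m.+1
  then 'X * \sum_(i < m.+1) e_A_coef i *: p (m - i)%N else 'X.
exists (fun m => if m == n then r else p m) => m.
rewrite ltnS leq_eqVlt; case: eqP => [-> _|_ /=]; last exact: pE.
move=> z zA; have [e0 _] := e_A_cvg zA; apply: (mulfI e0); rewrite /r.
case: n pE {r} => [|n] pE.
  by rewrite eisenstein1// hornerX /t_A divff.
rewrite eisenstein_recursion// hornerM hornerX mulrA /t_A divff// mul1r.
rewrite horner_sum; apply: eq_bigr => i _.
by rewrite hornerZ -pE// ltnS leq_subr.
Qed.

Lemma gossP n z : ~ range iota z ->
  eisenstein n.+1 z = (goss iota n.+1).[t_A iota z].
Proof.
have [p pE] := goss_exists n.+1.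
have : exists p : {poly C}, forall z, ~ range iota z ->
    eisenstein n.+1 z = p.[t_A iota z] by exists (p n); exact: pE.
by move=> /(xgetPex 0); exact.
Qed.

Local Notation T := (iota 'X).

(** * Convergence on Omega *)

Lemma vabs_T_gt1 : 1 < vabs T.
Proof.
by rewrite iota_abs ?polyX_eq0// size_polyX expr1 ltr1n card_finNzRing_gt1.
Qed.

Lemma vabs_TX_ge (B : R) : exists d, forall n, (d <= n)%N -> B <= vabs (T ^+ n).
Proof.
have [d Bd] := size_bounded B; exists d => n dn; rewrite -rmorphXn leNgt.
by apply/negP => /Bd; rewrite size_polyXn leqNgt ltnS dn.
Qed.

Lemma iota_vabs_lt1 (a : {poly F}) : vabs (iota a) < 1 -> a = 0.
Proof.
move=> a1; apply/eqP; apply: contraTT a1 => a0.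
by rewrite -leNgt iota_vabs_ge1.
Qed.

(** Approximate [z] by a fraction -d/c and take for [b] the quotient of [- (d * 'X^M)] by
    [c * 'X^N]. The precision [(vabs (T ^+ M))^-1] keeps the scaled error below 1, and the remainder
    divided by [c * 'X^N] is below 1 as well. *)
Lemma fraction_approx_round z (N M : nat) :
  (forall e : R, 0 < e -> exists c d : {poly F},
     c != 0 /\ vabs (iota c * z + iota d) < e * vabs (iota c)) ->
  exists b : {poly F}, vabs (T ^+ M * z / T ^+ N - iota b) < 1.
Proof.
move=> zapprox; have T0 : T != 0 by rewrite iota_neq0// polyX_eq0.
have TM0 : 0 < vabs (T ^+ M) by rewrite vabs_gt0 expf_neq0.
have [|c [d [c0 cd]]] := zapprox (vabs (T ^+ M))^-1; first by rewrite invr_gt0.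
have cN0 : c * 'X^N != 0 by rewrite mulf_neq0// expf_neq0// polyX_eq0.
pose b := (- (d * 'X^M)) %/ (c * 'X^N); pose r := (- (d * 'X^M)) %% (c * 'X^N).
have bE : iota b * (iota c * T ^+ N) + iota r = - (iota d * T ^+ M).
  by rewrite -!rmorphXn -!rmorphM -rmorphD -divp_eq rmorphN rmorphM.
exists b; have ic0 := iota_neq0 c0.
have -> : T ^+ M * z / T ^+ N - iota b =
    T ^+ M * (iota c * z + iota d) / (iota c * T ^+ N) +
    iota r / (iota c * T ^+ N).
  have -> : iota r = - (iota d * T ^+ M) - iota b * (iota c * T ^+ N).
    by rewrite -bE addrAC subrr add0r.
  have := expf_neq0 N T0; move: (T ^+ M) (T ^+ N) => x y y0.
  by field; apply/andP.
rewrite vabsD_lt// vabsM vabsV.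
  rewrite ltr_pdivrMr ?vabs_gt0 ?mulf_neq0 ?expf_neq0//.
  rewrite mul1r !vabsM -ltr_pdivlMl// (lt_le_trans cd)// ler_pM2l ?invr_gt0//.
  by rewrite ler_peMr ?vabs_ge0// vabsX exprn_ege1// ltW ?vabs_T_gt1.
rewrite ltr_pdivrMr ?vabs_gt0 ?mulf_neq0 ?expf_neq0// mul1r.
by rewrite -rmorphXn -rmorphM iota_vabs_size// ltn_modp.
Qed.

(** The polynomial [B M] rounds T^M z / T^(N+1), and the differences [B M.+1 - 'X * B M] are the
    digits of [z]. *)
Lemma Finfty_approx z :
  (forall e : R, 0 < e -> exists c d : {poly F},
     c != 0 /\ vabs (iota c * z + iota d) < e * vabs (iota c)) ->
  Finfty iota z.
Proof.
move=> zapprox; have T0 : T != 0 by rewrite iota_neq0// polyX_eq0.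
(* With z / T^(N+1) smaller than 1 the rounding starts at 0, so the expansion begins at T^N. *)
have [N zN] : exists N, vabs z < vabs (T ^+ N.+1).
  have [d dz] := vabs_TX_ge (vabs z + 1); exists d.
  by rewrite (lt_le_trans _ (dz _ _))// ltrDl.
have /choice[B BE] := fun M => fraction_approx_round N.+1 M zapprox.
have B0 : B 0%N = 0.
  apply: iota_vabs_lt1; rewrite -(subKr (z / T ^+ N.+1) (iota _)).
  rewrite vabsB_lt//; last by have := BE 0%N; rewrite expr0 mul1r.
  by rewrite vabsM vabsV ltr_pdivrMr ?mul1r// vabs_gt0 expf_neq0.
pose a M := B M.+1 - 'X * B M.
(* The digit is T times one rounding error minus another, hence smaller than T in absolute value,
   hence constant. *)
have aE M : a M = ((a M)`_0)%:P.
  apply: size1_polyC; rewrite leqNgt; apply/negP => a1.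
  have a0 : a M != 0 by rewrite -size_poly_gt0 (ltn_trans _ a1).
  have : vabs T <= vabs (iota (a M)).
    have q1 := ltnW (card_finNzRing_gt1 F).
    rewrite !iota_abs ?polyX_eq0// ler_weXn2l ?ler1n//.
    by rewrite size_polyX -ltnS (ltn_predK a1).
  apply/negP; rewrite -ltNge.
  have -> : iota (a M) = T * (T ^+ M * z / T ^+ N.+1 - iota (B M)) -
      (T ^+ M.+1 * z / T ^+ N.+1 - iota (B M.+1)).
    by rewrite /a rmorphB rmorphM; move: (T ^+ N.+1) => u; rewrite exprS; ring.
  have T1 := vabs_T_gt1.
  rewrite vabsB_lt// ?(lt_trans (BE _))// vabsM -[X in _ < X]mulr1.
  by rewrite ltr_pM2l// (lt_trans ltr01).
exists N, (fun i => (a i)`_0).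
(* The sum telescopes: its n-th term is T^(N-n) B_(n+1) - T^(N+1-n) B_n. *)
have -> : series (fun i => iota ((a i)`_0)%:P * (T ^+ N / T ^+ i)) =
    (fun n => T ^+ N.+1 / T ^+ n * iota (B n)).
  apply/funext; elim=> [|n IH].
    by rewrite /series /= big_geq// B0 rmorph0 mulr0.
  rewrite seriesSr IH -aE /a rmorphB rmorphM.
  move: (iota (B n.+1)) (iota (B n)) => x y; rewrite !exprS.
  have := expf_neq0 n T0; move: (T ^+ N) (T ^+ n) => u v v0.
  by field; apply/andP.
apply/cvg_vabsP => e e0; have [d de] := vabs_TX_ge (vabs (T ^+ N.+1) / e).
exists d => // n /= /de; have := BE n; have := expf_neq0 n T0.
have := expf_neq0 N.+1 T0; move: (T ^+ N.+1) (T ^+ n) => u v u0 v0 Bn uv.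
have -> : u / v * iota (B n) - z = u / v * (iota (B n) - v * z / u).
  by field; apply/andP.
rewrite vabsM vabs_distC (@lt_le_trans _ _ (vabs (u / v) * 1))//.
  by rewrite ltr_pM2l// vabs_gt0 mulf_neq0// invr_eq0.
by rewrite mulr1 vabsM vabsV ler_pdivrMr ?vabs_gt0// mulrC -ler_pdivrMr.
Qed.

(** Contrapositive of [Finfty_approx]: a point that fractions -d/c approximate arbitrarily well lies
    in [Finfty]. *)
Lemma linear_form_ge z : Omega iota z -> exists2 e : R, 0 < e &
  forall c d : {poly F}, e * vabs (iota c) <= vabs (iota c * z + iota d).
Proof.
move=> zO; apply: contrapT => ne; apply: zO; apply: Finfty_approx => e e0.
apply: contrapT => ncd; apply: ne; exists e => // c d.
have [->|c0] := eqVneq c 0; first by rewrite rmorph0 vabs0 mulr0 vabs_ge0.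
by rewrite leNgt; apply/negP => cd; apply: ncd; exists c, d.
Qed.

Lemma linear_form_ge_cst z : Omega iota z -> exists2 e : R, 0 < e &
  forall c d : {poly F}, (c != 0) || (d != 0) ->
    e <= vabs (iota c * z + iota d).
Proof.
move=> /linear_form_ge[e e0 ecd]; exists (Num.min e 1).
  by rewrite lt_min e0 ltr01.
move=> c d; have [->/= d0|c0 _] := eqVneq c 0.
  by rewrite rmorph0 mul0r add0r ge_min iota_vabs_ge1 ?orbT.
rewrite (le_trans _ (ecd c d))// ge_min; apply/orP; left.
by rewrite ler_peMr ?iota_vabs_ge1// ltW.
Qed.

(** Discreteness of the lattice Az + A: a bound on the form bounds [c] by [linear_form_ge], and then
    [d] as the difference of the form and cz. *)
Lemma linear_form_bounded z (B : R) : Omega iota z -> exists n, forall c d,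
  vabs (iota c * z + iota d) < B -> (size c <= n)%N /\ (size d <= n)%N.
Proof.
move=> /linear_form_ge[e e0 ecd].
have [n1 n1P] := size_bounded (B / e).
have [n2 n2P] := size_bounded (Num.max B (B / e * vabs z + 1)).
exists (maxn n1 n2) => c d cdB.
have cB : vabs (iota c) < B / e.
  by rewrite ltr_pdivlMr// mulrC (le_lt_trans (ecd c d)).
split; first by rewrite leq_max n1P.
rewrite leq_max n2P ?orbT// -(addKr (iota c * z) (iota d)) vabsD_lt//.
  rewrite vabsN vabsM lt_max; apply/orP; right.
  rewrite (@le_lt_trans _ _ (B / e * vabs z)) ?ltrDl//.
  by rewrite ler_wpM2r ?vabs_ge0 ?ltW.
by rewrite lt_max cdB.
Qed.

Lemma finite_matrices (m n d : nat) (D : set 'M[{poly F}]_(m, n)) :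
  (forall g, D g -> forall i j, (size (g i j) <= d)%N) -> finite_set D.
Proof.
move=> Dd; apply: (finite_subfset
  [fset map_mx rVpoly v | v in [set: 'M['rV[F]_d]_(m, n)]%SET]%fset) => g Dg.
apply/imfsetP; exists (map_mx poly_rV g); first by rewrite inE.
by apply/matrixP => i j; rewrite !mxE poly_rV_K// Dd.
Qed.

Lemma GL2A_row_neq0 (g : 'M[{poly F}]_2) (i : 'I_2) : GL2A g ->
  (g i 0 != 0) || (g i 1 != 0).
Proof.
move=> gG; rewrite -negb_and; apply/negP => /andP[/eqP g0 /eqP g1].
move: gG; rewrite /GL2A /= unitmxE (expand_det_row _ i).
rewrite !big_ord_recl big_ord0 g0 (_ : lift _ _ = 1); last exact/val_inj.
by rewrite g1 !mul0r !addr0 unitr0.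
Qed.

Lemma det_GL2A (g : 'M[{poly F}]_2) : GL2A g ->
  exists2 u : F, u != 0 & \det g = u%:P.
Proof.
rewrite /GL2A /= unitmxE poly_unitE => /andP[/eqP s1 u0].
exists (\det g)`_0; first by rewrite -unitfE.
by apply: size1_polyC; rewrite s1.
Qed.

Lemma vabs_iotaC (u : F) : u != 0 -> vabs (iota u%:P) = 1.
Proof. by move=> u0; rewrite iota_abs ?polyC_eq0// size_polyC u0 expr0. Qed.

(** The summand has absolute value |(az + b)(cz + d)|^(-k), and each factor is at least [r]. A bound
    on the product thus bounds each factor, and with it the degrees of all entries. *)
Lemma rho_vanishing k z : (0 < k)%N -> Omega iota z ->
  vanishing (@GL2A F) (rho_term iota k z).
Proof.
move=> k0 zO e e0; have [r r0 rP] := linear_form_ge_cst zO.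
have [B [B1 Be]] : exists B : R, 1 <= B /\ e^-1 < B.
  exists (Num.max 1 (e^-1 + 1)); rewrite !le_max lexx; split => //.
  by rewrite lt_max ltrDl ltr01 orbT.
have [n nP] := linear_form_bounded (B / r) zO.
apply: (@finite_matrices _ _ n) => g [gG].
have [u u0 gu] := det_GL2A gG.
rewrite /rho_term gu vabsM vabsX vabs_iotaC// expr1n mul1r -exprMn vabsV vabsX.
rewrite vabsM => eNJ.
have N0 : r <= vabs (numer iota g z) by apply: rP; exact: GL2A_row_neq0.
have J0 : r <= vabs (autom iota g z) by apply: rP; exact: GL2A_row_neq0.
have NJ : vabs (numer iota g z) * vabs (autom iota g z) < B.
  rewrite ltNge; apply/negP => BNJ; move: eNJ; apply/negP.
  have NJ1 := le_trans B1 BNJ; have NJ0 := lt_le_trans ltr01 NJ1.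
  rewrite -ltNge invf_plt ?posrE ?exprn_gt0// (lt_le_trans Be)//.
  by rewrite (le_trans BNJ)// ler_eXnr.
have [a b] : vabs (numer iota g z) < B / r /\ vabs (autom iota g z) < B / r.
  split; rewrite ltr_pdivlMr//; apply: le_lt_trans NJ.
    by rewrite ler_wpM2l ?vabs_ge0.
  by rewrite mulrC ler_wpM2r ?vabs_ge0.
have [[? ?] [? ?]] := (nP _ _ a, nP _ _ b).
by apply: ord2_ind; apply: ord2_ind.
Qed.

(** * Summation over the cosets of K *)

Implicit Type g : 'M[{poly F}]_2.

Lemma autom_neq0 z g : Omega iota z -> GL2A g -> autom iota g z != 0.
Proof.
move=> /linear_form_ge_cst[e e0 eP] gG; rewrite -vabs_gt0 (lt_le_trans e0)//.
by apply: eP; exact: GL2A_row_neq0.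
Qed.

Lemma numer_neq0 z g : Omega iota z -> GL2A g -> numer iota g z != 0.
Proof.
move=> /linear_form_ge_cst[e e0 eP] gG; rewrite -vabs_gt0 (lt_le_trans e0)//.
by apply: eP; exact: GL2A_row_neq0.
Qed.

Definition kmx (u : F) (b : {poly F}) : 'M[{poly F}]_2 :=
  \matrix_(i, j) if i == 0 then if j == 0 then u%:P else b else (j == 1)%:R.

Lemma kmx_mulE u b g j : (kmx u b *m g) 0 j = u%:P * g 0 j + b * g 1 j /\
  (kmx u b *m g) 1 j = g 1 j.
Proof.
rewrite !mxE !big_ord_recl !big_ord0 !mxE /=.
rewrite (_ : lift _ _ = 1); last exact/val_inj.
by rewrite addr0 mul0r add0r mul1r addr0.
Qed.

Lemma KsubP h : Ksub h <-> exists2 u, u != 0 & exists b, h = kmx u b.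
Proof.
split=> [[[u u0 hu] h10 h11]|[u u0 [b ->]]]; last first.
  by split; rewrite ?mxE//=; exists u.
exists u => //; exists (h 0 1); apply/matrixP.
by apply: ord2_ind; apply: ord2_ind; rewrite mxE.
Qed.

Lemma kmxM u v b c : kmx u b *m kmx v c = kmx (u * v) (u%:P * c + b).
Proof.
apply/matrixP; apply: ord2_ind => j; have [E0 E1] := kmx_mulE u b (kmx v c) j.
- rewrite E0 !mxE /=; move: j {E0 E1}; apply: ord2_ind => /=.
    by rewrite mulr0 addr0 polyCM.
  by rewrite mulr1.
- by rewrite E1 !mxE.
Qed.

Lemma kmx1 : kmx 1 0 = 1%:M.
Proof.
by apply/matrixP; apply: ord2_ind; apply: ord2_ind; rewrite !mxE.
Qed.

Lemma det_kmx u b : \det (kmx u b) = u%:P.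
Proof. by rewrite det_mx2 !mxE /= mulr1 mulr0 subr0. Qed.

Lemma GL2A_kmx u b g : u != 0 -> GL2A g -> GL2A (kmx u b *m g).
Proof.
rewrite /GL2A /= => u0 gG; rewrite unitmx_mul gG andbT unitmxE det_kmx.
by rewrite poly_unitE size_polyC u0 coefC eqxx unitfE.
Qed.

Lemma numer_kmx u b g z : numer iota (kmx u b *m g) z =
  iota u%:P * numer iota g z + iota b * autom iota g z.
Proof.
rewrite /numer /autom; have [-> _] := kmx_mulE u b g 0.
by have [-> _] := kmx_mulE u b g 1; rewrite !rmorphD !rmorphM; ring.
Qed.

Lemma autom_kmx u b g z : autom iota (kmx u b *m g) z = autom iota g z.
Proof.
rewrite /autom; have [_ ->] := kmx_mulE u b g 0.
by have [_ ->] := kmx_mulE u b g 1.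
Qed.

(** If gz were some b in A, translating by -b would give an element of GL_2(A) whose numerator
    vanishes at [z]. *)
Lemma moebius_notin_A z g : Omega iota z -> GL2A g ->
  ~ range iota (moebius iota g z).
Proof.
move=> zO gG [b _ bE].
have /eqP := numer_neq0 zO (GL2A_kmx (- b) (oner_neq0 F) gG); apply.
rewrite numer_kmx rmorph1 mul1r rmorphN mulNr bE /moebius.
by rewrite divfK ?autom_neq0// subrr.
Qed.

Lemma K_coset_refl g : K_coset g g.
Proof.
exists 1%:M; last by rewrite mul1mx.
by apply/KsubP; exists 1; rewrite ?oner_neq0//; exists 0; rewrite kmx1.
Qed.

Lemma K_coset_eq g x : K_coset g x -> K_coset x = K_coset g.
Proof.
move=> [h /KsubP[u u0 [b ->]] <-]; apply/seteqP.
split=> _ [_ /KsubP[v v0 [c ->]] <-].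
- rewrite mulmxA kmxM; exists (kmx (v * u) (v%:P * b + c)) => //.
  by apply/KsubP; exists (v * u); [rewrite mulf_neq0|eexists].
- exists (kmx (v / u) (c - (v / u)%:P * b)).
    by apply/KsubP; exists (v / u); [rewrite mulf_neq0 ?invr_eq0|eexists].
  by rewrite mulmxA kmxM divfK// subrKC.
Qed.

Lemma K_coset_GL2A g x : GL2A g -> K_coset g x -> GL2A x.
Proof. by move=> gG [h /KsubP[u u0 [b ->]] <-]; exact: GL2A_kmx. Qed.

(** Translation by 1 permutes F, so the sum of all elements of F is unchanged by adding [#|F|]. *)
Lemma card_F_eq0 : #|F|%:R = 0 :> C.
Proof.
suff cF : #|F|%:R = 0 :> F.
  by rewrite -(rmorph_nat iota) -polyC_natr cF rmorph0.
apply: (addrI (\sum_(x : F) x)); rewrite addr0.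
by rewrite [RHS](reindex_inj (addIr 1)) big_split /= sumr_const.
Qed.

(** With upper right entry -ub the numerator acquires a factor u, whose k-th power cancels the one
    coming from the determinant. *)
Lemma rho_term_kmx k z g u b : Omega iota z -> GL2A g -> u != 0 ->
  rho_term iota k z (kmx u (- (u%:P * b)) *m g) =
  iota (\det g) ^+ k / autom iota g z ^+ (2 * k) *
    (moebius iota g z - iota b) ^- k.
Proof.
move=> zO gG u0; have J0 := autom_neq0 zO gG.
have u0' : iota u%:P != 0 by rewrite iota_neq0// polyC_eq0.
set m := moebius iota g z - iota b.
have m0 : m != 0.
  by apply/eqP => /subr0_eq mb; apply: (moebius_notin_A zO gG); exists b.
rewrite /rho_term numer_kmx autom_kmx det_mulmx det_kmx rmorphN !rmorphM mulNr.
have -> : iota u%:P * numer iota g z - iota u%:P * iota b * autom iota g z =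
    iota u%:P * m * autom iota g z.
  by rewrite /m /moebius; field.
rewrite !exprMn mulnC exprM.
have := expf_neq0 k u0'; have := expf_neq0 k m0; have := expf_neq0 k J0.
move: (_ ^+ k) (_ ^+ k) (_ ^+ k) => x y w x0 y0 w0.
by field; rewrite x0 y0.
Qed.

Lemma rho_coset_sum k z g : Omega iota z -> GL2A g ->
  usums (K_coset g) (rho_term iota k.+1 z) -->
  - (iota (\det g) ^+ k.+1 / autom iota g z ^+ (2 * k.+1) *
     eisenstein k.+1 (moebius iota g z)).
Proof.
move=> zO gG; set c := iota _ ^+ _ / _ * _.
have fv : vanishing (K_coset g) (rho_term iota k.+1 z).
  apply: vanishing_sub (rho_vanishing (ltn0Sn k) zO) => x.
  exact: K_coset_GL2A.
have fs := vanishing_usummable fv.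
(* On the coset the determinant is [u * d], so the fibres of [lead] are the sets with fixed [u];
   each is parametrised by [b] and has sum [c]. *)
pose lead (x : 'M[{poly F}]_2) : F := (\det x)`_0.
have [d d0 gd] := det_GL2A gG.
have leadE u b : lead (kmx u b *m g) = u * d.
  by rewrite /lead det_mulmx det_kmx gd -polyCM coefC.
have imlead : lead @` K_coset g = [set v | v != 0].
  apply/seteqP; split=> [_ [_ [h /KsubP[u u0 [b ->]] <-] <-]|v /= v0].
    by rewrite leadE /= mulf_neq0.
  exists (kmx (v / d) 0 *m g); last by rewrite leadE divfK.
  exists (kmx (v / d) 0) => //; apply/KsubP; exists (v / d); last by eexists.
  by rewrite mulf_neq0 ?invr_eq0.
have fiber v : (lead @` K_coset g) v ->
    usums [set x | K_coset g x /\ lead x = v] (rho_term iota k.+1 z) --> c.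
  rewrite imlead => /= v0; pose u := v / d.
  have u0 : u != 0 by rewrite mulf_neq0 ?invr_eq0.
  pose h b := kmx u (- (u%:P * b)) *m g.
  have hi : {in setT &, injective h}.
    move=> b1 b2 _ _ /(congr1 (mulmx^~ (invmx g))).
    rewrite !mulmxK// => /matrixP/(_ 0 1); rewrite !mxE /= => /oppr_inj.
    by apply: mulfI; rewrite polyC_eq0.
  have hE : [set x | K_coset g x /\ lead x = v] = h @` setT.
    apply/seteqP; split=> [x [[y /KsubP[u' u'0 [b ->]] <-]]|_ [b _ <-]].
      rewrite leadE => uv; have -> : u' = u by rewrite /u -uv mulfK.
      exists (- (u^-1%:P * b)) => //; rewrite /h mulrN opprK mulrA -polyCM.
      by rewrite divff// mul1r.
    split; last by rewrite leadE divfK.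
    exists (kmx u (- (u%:P * b))) => //.
    by apply/KsubP; exists u => //; eexists.
  rewrite hE; apply: usums_inj => //.
    by apply: vanishing_sub fv; rewrite -hE => x [].
  rewrite (@eq_usums _ _ _ _ _ (fun b => iota (\det g) ^+ k.+1 /
    autom iota g z ^+ (2 * k.+1) * (moebius iota g z - iota b) ^- k.+1)).
    apply/usumsMl/vanishing_usummable/eisenstein_vanishing.
    exact: moebius_notin_A.
  by move=> b _; rewrite /= rho_term_kmx.
have := usums_fibers fv fs fiber; rewrite imlead => cs.
suff <- : usum (K_coset g) (rho_term iota k.+1 z) = - c by [].
pose S : {fset F} := [fset v | v in [pred v : F | v != 0]]%fset.
have SE (v : F) : [set v | v != 0] v <-> v \in S.
  by rewrite inE.
apply: vcvg_unique cs _.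
suff <- : \sum_(v <- S) c = - c by exact: usums_finite.
rewrite (perm_big (enum [pred v : F | v != 0])); last first.
  apply: uniq_perm; rewrite ?fset_uniq ?enum_uniq// => v.
  by rewrite mem_enum; apply/idP/idP => /SE.
(* Adding a term for [v = 0] turns the q - 1 equal terms into q copies of [c], whose sum is 0. *)
rewrite big_enum /=; apply: (addrI c); rewrite subrr.
have cF : c *+ #|F| = 0 by rewrite -mulr_natr card_F_eq0 mulr0.
by rewrite -[RHS]cF -[RHS]sumr_const [RHS](bigD1 0).
Qed.

Lemma iota_det_expr_mod g n : GL2A g ->
  iota (\det g) ^+ (n %% #|F|.-1) = iota (\det g) ^+ n.
Proof.
move=> /det_GL2A[u u0 ->].
rewrite [in RHS](divn_eq n #|F|.-1) exprD mulnC exprM.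
suff -> : iota u%:P ^+ #|F|.-1 = 1 by rewrite expr1n mul1r.
rewrite -rmorphXn -polyC_exp (_ : u ^+ _ = 1) ?rmorph1//.
apply: (mulfI u0); rewrite -exprS prednK ?mulr1 ?expf_card//.
exact: ltnW (card_finNzRing_gt1 F).
Qed.

(** The witness [g] is the very representative that [K_repr] picks, so only the exponent of the
    determinant and the Goss polynomial have to be rewritten. *)
Lemma poincare_term_coset k z (X : set 'M[{poly F}]_2) :
  Omega iota z -> KG X ->
  exists2 g, GL2A g & X = K_coset g /\
    poincare_term iota (2 * k.+1) k.+1 z X =
    iota (\det g) ^+ k.+1 / autom iota g z ^+ (2 * k.+1) *
      eisenstein k.+1 (moebius iota g z).
Proof.
move=> zO [g0 g0G <-]; rewrite /poincare_term; set g := K_repr _.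
have gX : K_coset g0 g by apply: xgetPex; exists g0; exact: K_coset_refl.
have gG := K_coset_GL2A g0G gX.
exists g => //; split; first by rewrite (K_coset_eq gX).
by rewrite iota_det_expr_mod// gossP//; exact: moebius_notin_A.
Qed.

Lemma poincare_usums k z : Omega iota z ->
  usums (@KG F) (poincare_term iota (2 * k.+1) k.+1 z) --> - rho iota k.+1 z.
Proof.
move=> zO; have fv := rho_vanishing (ltn0Sn k) zO.
have fs := vanishing_usummable fv.
have : usums (@KG F) (fun X => - poincare_term iota (2 * k.+1) k.+1 z X) -->
    rho iota k.+1 z.
  (* [KG] is the image of [GL2A] under [K_coset], and the fibre of this map over a coset is the
     coset itself, whose sum is given by [rho_coset_sum]. *)
  apply: usums_fibers fv fs _ => X XG.
  have [g gG [-> ->]] := poincare_term_coset k zO XG.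
  rewrite (_ : [set x | _] = K_coset g); first exact: rho_coset_sum.
  apply/seteqP; split=> [x [_ <-]|x gx]; first exact: K_coset_refl.
  by split; [exact: K_coset_GL2A gx|exact: K_coset_eq].
move=> /(usumsMl (a := -1)); rewrite mulN1r.
rewrite (@eq_usums _ _ _ _ _ (poincare_term iota (2 * k.+1) k.+1 z))//.
by move=> X _; rewrite mulN1r opprK.
Qed.

(** * Derivatives of Moebius transformations and pullbacks *)

Lemma dnbhs0_proper : ProperFilter (0 : C)^'.
Proof.
apply: Build_ProperFilter_ex => P /nbhs_ballP[e /= e0 Pe].
(* The inverse of a high power of T is a nonzero point close to 0. *)
have [n nP] := vabs_TX_ge (e^-1 + 1).
have T0 : T ^+ n != 0 by rewrite expf_neq0// iota_neq0// polyX_eq0.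
exists (T ^+ n)^-1; apply: Pe; last by rewrite invr_eq0.
rewrite ballEmdist /= metric_sym mdistE subr0 vabsV invf_plt ?posrE ?vabs_gt0//.
by rewrite (lt_le_trans _ (nP _ (leqnn n)))// ltrDl.
Qed.

Lemma deriv_moebius z g : Omega iota z -> GL2A g ->
  deriv_at (moebius iota g) z = iota (\det g) / autom iota g z ^+ 2.
Proof.
move=> zO gG; have J0 := autom_neq0 zO gG.
have FP := dnbhs0_proper; rewrite /deriv_at; apply: vlimP.
have h0 : (fun h : C => h) @ 0^' --> (0 : C).
  by apply: cvg_within_filter; exact: cvg_id.
have Jc : (fun h => autom iota g z + iota (g 1 0) * h) @ 0^' -->
    autom iota g z + iota (g 1 0) * 0.
  by apply: vcvgD; [exact: vcvg_cst|exact: vcvgMl].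
rewrite mulr0 addr0 in Jc.
(* For small nonzero h this is the difference quotient, since j(z + h) = j(z) + ch; there
   [vcvg_near0] keeps j(z + h) nonzero. *)
have : (fun h => iota (\det g) /
    ((autom iota g z + iota (g 1 0) * h) * autom iota g z)) @ 0^' -->
    iota (\det g) / (autom iota g z * autom iota g z).
  apply/vcvgMl/vcvgV; first by rewrite mulf_neq0.
  by apply: vcvgM => //; exact: vcvg_cst.
rewrite -expr2; apply: cvg_trans; apply: near_eq_cvg.
have hn0 : \forall h \near (0 : C)^', h != 0 by exact: withinT.
apply: filterS2 (vcvg_near0 J0 Jc) hn0 => h; rewrite -!vabs_gt0 => Jh h1.
have {Jh} : autom iota g z + iota (g 1 0) * h != 0.
  by rewrite -vabs_gt0 Jh vabs_gt0.
have -> : iota (\det g) =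
    iota (g 0 0) * iota (g 1 1) - iota (g 0 1) * iota (g 1 0).
  by rewrite det_mx2 rmorphB !rmorphM.
move: h1 J0; rewrite vabs_gt0 /moebius /numer /autom.
move: (iota _) (iota _) (iota _) (iota _) => a b c d h1 J0 J1.
by field; rewrite h1 J0 mulrDr addrAC.
Qed.

(** In the product of (gz)^(-1) and det(g) j_g(z)^(-2), one factor j_g(z) cancels. *)
Lemma rho_term_pullback k z g : Omega iota z -> GL2A g ->
  rho_term iota k z g =
  pullback k (moebius iota g) (fun x => s_infty_0 x ^+ k) z.
Proof.
move=> zO gG; rewrite /rho_term /pullback /s_infty_0 deriv_moebius// -!exprMn.
rewrite -expr_div_n; congr (_ ^+ k); rewrite /moebius.
by field; rewrite numer_neq0 ?autom_neq0.
Qed.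

End FunctionField.

Theorem proposition6p2p2 (R : realType) (F : finFieldType)
    (C : completeUltrametricFieldType R) (iota : {rmorphism {poly F} -> C})
    (k : nat) :
  odd #|F| -> is_Cinfty iota -> (0 < k)%N ->
  [/\ forall z : C, Omega iota z ->
        usummable (@GL2A F) (rho_term iota k z) /\
        usummable (@KG F) (poincare_term iota (2 * k) k z),
      forall z : C, Omega iota z ->
        rho iota k z =
        usum (@GL2A F)
          (fun g => pullback k (moebius iota g) (fun x => s_infty_0 x ^+ k) z)
    & forall z : C, Omega iota z ->
        rho iota k z = - poincare iota (2 * k) k z].
Proof.
move=> _ [iota_abs _ _]; case: k => // k _; split=> z zO.
- split; first exact/vanishing_usummable/rho_vanishing.
  (* Summability of the Poincare series comes with its value, from regrouping [rho] by cosets. *)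
  exact: cvgP (poincare_usums iota_abs zO).
- by apply: eq_usum => g gG; exact: rho_term_pullback.
- by rewrite /poincare /usum (vlimP (poincare_usums iota_abs zO)) opprK.
Qed.
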